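(* Let $n \geq 1$. If $x$ is a non-zero element of $A_n$, then $\dim_{\mathbb{R}} (\operatorname{Ann} x) \leq 2^n-4n+4$. Moreover, if $d$ is any multiple of $4$ such that $0\leq d \leq 2^n-4n+4$, then there exist elements of $A_n$ whose annihilators have real dimension $d$.
   Context: The Cayley-Dickson algebras $A_n$ are the finite-dimensional, generally non-associative, real algebras with linear involution $x\mapsto x^*$ defined inductively: $A_0=\mathbb{R}$ with trivial involution, and $A_n = A_{n-1}\times A_{n-1}$ additively, with multiplication $(a,b)(c,d) = (ac - d^* b,\ da + bc^* )$ and involution $(a,b)^* = (a^*,-b)$. Thus $\dim_{\mathbb{R}} A_n = 2^n$. For $x\in A_n$, the annihilator of $x$ is the real subspace $\operatorname{Ann} x=\{y\in A_n : xy=0\}$. *)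

(* Defs.v *)
From HB Require Import structures.
From mathcomp Require Import all_boot all_order all_algebra.
From mathcomp Require Import reals.

Set Implicit Arguments.
Unset Strict Implicit.
Unset Printing Implicit Defensive.

Import GRing.Theory.
Local Open Scope ring_scope.

Section CayleyDickson.
Variable R : realType.

(* Only the vector space structure is canonical; the non-associative product
   is the separate operation cd_mul. *)
Fixpoint cayley_dickson (n : nat) : vectType R :=
  if n is m.+1 then (cayley_dickson m * cayley_dickson m)%type : vectType R
  else R^o.

Fixpoint cd_conj (n : nat) : cayley_dickson n -> cayley_dickson n :=
  match n return cayley_dickson n -> cayley_dickson n with
  | 0 => fun x => x
  | m.+1 => fun x : cayley_dickson m * cayley_dickson m =>
      (cd_conj x.1, - x.2)
  end.

Fixpoint cd_mul (n : nat) :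
    cayley_dickson n -> cayley_dickson n -> cayley_dickson n :=
  match n return
    cayley_dickson n -> cayley_dickson n -> cayley_dickson n with
  | 0 => fun x y : R => x * y
  | m.+1 => fun x y : cayley_dickson m * cayley_dickson m =>
      let: (a, b) := x in
      let: (c, d) := y in
      (cd_mul a c - cd_mul (cd_conj d) b, cd_mul d a + cd_mul b (cd_conj c))
  end.

Lemma cd_conj_is_linear (n : nat) : linear (@cd_conj n).
Proof.
elim: n => [//|n IHn] k [a b] [c d] /=.
by congr (_, _); rewrite /= ?IHn // opprD scalerN.
Qed.

Lemma cd_mul_is_bilinear (n : nat) (x : cayley_dickson n) :
  linear (cd_mul x) /\ linear (fun y => cd_mul y x).
Proof.
elim: n x => [|n IHn] /= x.
  split=> k y z.
    by change (x * (k * y + z) = k * (x * y) + x * z); rewrite mulrDr mulrCA.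
  by change ((k * y + z) * x = k * (y * x) + z * x); rewrite mulrDl mulrA.
have mul_linear_r (u : cayley_dickson n) : linear (cd_mul u) by case: (IHn u).
have mul_linear_l (u : cayley_dickson n) : linear (fun y => cd_mul y u) by case: (IHn u).
case: x => a b; split=> k [c d] [e f] /=;
  rewrite ?cd_conj_is_linear ?mul_linear_r ?mul_linear_l; congr (_, _) => /=;
  by rewrite ?(scalerBr, scalerDr) ?opprD addrACA.
Qed.

HB.instance Definition _ (n : nat) (x : cayley_dickson n) :=
  GRing.isLinear.Build R (cayley_dickson n) (cayley_dickson n) *:%R
    (cd_mul x) (proj1 (cd_mul_is_bilinear x)).

Definition Ann (n : nat) (x : cayley_dickson n) : {vspace cayley_dickson n} :=
  lker (linfun (cd_mul x)).

Lemma mem_Ann (n : nat) (x y : cayley_dickson n) :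
  (y \in Ann x) = (cd_mul x y == 0).
Proof. by rewrite memv_ker lfunE. Qed.

Lemma dim_cayley_dickson (n : nat) : dim (cayley_dickson n) = (2 ^ n)%N.
Proof. by elim: n => [//|n IHn]; rewrite expnS mul2n -addnn -IHn. Qed.

End CayleyDickson.

(* Main.v *)
Require Import Defs.
From HB Require Import structures.
From mathcomp Require Import all_boot all_order all_algebra.
From mathcomp Require Import reals.
From mathcomp Require Import ring lra zify.

(** Write i = (0, 1) for the last imaginary unit of A_n and C = span(1, i); an
    element is called doubly pure when it is orthogonal to C.  Left
    multiplication by a doubly pure x anticommutes with left multiplication by
    i, and both are skew-symmetric.  Hence if x y = 0 with y <> 0, then pairing x y
    with y and with i y shows that the coordinates of x along 1 and i vanish.  By
    conjugation the same holds for y if x <> 0, so zero divisors and the elements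
    that they annihilate are doubly pure (zero_divisor_doubly_pure).

    The main tool is a splitting of A_(n+1).  Every pair of doubly pure elements
    of A_n can be written uniquely as pm a b = (a + b, i (a - b)), with a and b
    doubly pure, and in the product pm a b ** pm c d the cross terms a d and b c
    survive only through their components in C (cd_mul_pm).  So pm c d
    annihilates pm a b exactly when a c and b d lie in C and four real linear
    equations hold (cd_mul_pm_eq0).  The doubly pure c with a c in C form a space
    of dimension dim Ann a + 2 if a <> 0, and 2^n - 2 if a = 0.  With a <> 0 this
    gives, writing N = 2^n,

    - dim Ann (pm a 0) = dim Ann a + N - 4 (dim_Ann_pm0);
    - dim Ann (pm a b) = dim Ann a + dim Ann b if <a, b> <> 0 (dim_Ann_pm_add);
    - dim Ann (pm a b) <= dim Ann a + dim Ann b + 4 if b <> 0 (dim_Ann_pm_le).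

    Upper bound (dim_Ann_le).  Put f n = 2^n - 4 n + 4, so that
    f (n + 1) = f n + N - 4.  A zero divisor in A_(n+1) is either some pm a b, and
    then the first and the third fact give the inductive step (the automorphism
    (u, v) |-> (u, - v) exchanges a and b, so a <> 0 may be assumed), or one of its
    two components is not doubly pure; in the latter case it annihilates no
    nonzero (w, - i w), so its annihilator has dimension at most N
    (dim_Ann_not_pm), and N <= f (n + 1) as soon as n >= 4.  The
    inductive step thus starts from A_4.  There the bound 4 follows from the alternativity of the octonions: if (c, d)
    annihilates (a, b), then d is orthogonal to 1, a, b and a b
    (dim_Ann_over_alternative).  In A_2 and A_3 alternativity rules out zero
    divisors, and in A_1 the bound is the dimension of the algebra.

    Existence (annihilator_family).  For n >= 3 one builds, by induction on n,
    elements F d of A_n with annihilators of dimension 4 d for all admissible d,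
    and with pairwise positive inner products.  In A_(n+1) one takes
    pm (F d') 0 for the dimensions from N - 4 on, and pm (F d1) (F d2) with
    d = d1 + d2 below; the positivity is what makes the second fact apply, and it
    is inherited by the new family because the splitting is orthogonal. *)

Set Implicit Arguments.
Unset Strict Implicit.
Unset Printing Implicit Defensive.

Import Order.TTheory GRing.Theory Num.Theory.
Local Open Scope ring_scope.

Section CayleyDicksonAnnihilators.
Variable R : realType.
Local Notation A := (cayley_dickson R).
Local Notation "x ** y" := (cd_mul x y) (at level 38, left associativity).
Local Notation cj := (@cd_conj R _).

(** * Bilinearity, conjugation and unit *)

Lemma cd_conjD n (x y : A n) : cj (x + y) = cj x + cj y.
Proof. by have := cd_conj_is_linear 1 x y; rewrite !scale1r. Qed.

Lemma cd_conj0 n : cj (0 : A n) = 0.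
Proof. by apply: (addIr (cj 0)); rewrite -cd_conjD !add0r. Qed.

Lemma cd_conjZ n k (x : A n) : cj (k *: x) = k *: cj x.
Proof. by have := cd_conj_is_linear k x 0; rewrite cd_conj0 !addr0. Qed.

Lemma cd_conjN n (x : A n) : cj (- x) = - cj x.
Proof. by rewrite -scaleN1r cd_conjZ scaleN1r. Qed.

Lemma cd_conjB n (x y : A n) : cj (x - y) = cj x - cj y.
Proof. by rewrite cd_conjD cd_conjN. Qed.

Lemma cd_conjK n : involutive (@cd_conj R n).
Proof. by elim: n => [//|n IH] [a b] /=; rewrite IH opprK. Qed.

Lemma cd_mulDl n (x y z : A n) : (x + y) ** z = x ** z + y ** z.
Proof. by have [_ /(_ 1 x y)] := cd_mul_is_bilinear z; rewrite !scale1r. Qed.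

Lemma cd_mulDr n (x y z : A n) : z ** (x + y) = z ** x + z ** y.
Proof. exact: linearD. Qed.

Lemma cd_mul0l n (x : A n) : 0 ** x = 0.
Proof. by apply: (addIr (0 ** x)); rewrite -cd_mulDl !add0r. Qed.

Lemma cd_mul0r n (x : A n) : x ** 0 = 0.
Proof. exact: linear0. Qed.

Lemma cd_mulZr n k (x y : A n) : x ** (k *: y) = k *: (x ** y).
Proof. exact: linearZ. Qed.

Lemma cd_mulZl n k (x y : A n) : (k *: x) ** y = k *: (x ** y).
Proof.
by have [_ /(_ k x 0)] := cd_mul_is_bilinear y; rewrite cd_mul0l !addr0.
Qed.

Lemma cd_mulNr n (x y : A n) : x ** - y = - (x ** y).
Proof. exact: linearN. Qed.

Lemma cd_mulNl n (x y : A n) : - x ** y = - (x ** y).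
Proof. by rewrite -scaleN1r cd_mulZl scaleN1r. Qed.

(** The pair constructor typed in the doubled algebra; rewriting with its equations
    keeps the recursive definition of the product folded. *)
Definition cd_pair n (a b : A n) : A n.+1 := (a, b).
Lemma cd_pair_ind n (P : A n.+1 -> Prop) : (forall a b, P (cd_pair a b)) -> forall x, P x.
Proof. by move=> H [a b]; exact: H. Qed.

Lemma cd_mul_pair n (a b c d : A n) :
  cd_pair a b ** cd_pair c d = cd_pair (a ** c - cj d ** b) (d ** a + b ** cj c).
Proof. by []. Qed.

Lemma cd_conj_pair n (a b : A n) : cj (cd_pair a b) = cd_pair (cj a) (- b).
Proof. by []. Qed.

Lemma cd_pairD n (a b c d : A n) : cd_pair a b + cd_pair c d = cd_pair (a + c) (b + d).
Proof. by []. Qed.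

Lemma cd_pairN n (a b : A n) : - cd_pair a b = cd_pair (- a) (- b).
Proof. by []. Qed.

Lemma cd_pairZ n k (a b : A n) : k *: cd_pair a b = cd_pair (k *: a) (k *: b).
Proof. by []. Qed.

Lemma cd_pair0 n : cd_pair 0 0 = 0 :> A n.+1.
Proof. by []. Qed.

Lemma cd_pair_inj n (a b c d : A n) : cd_pair a b = cd_pair c d -> a = c /\ b = d.
Proof. by case. Qed.

Lemma cd_conjM n (x y : A n) : cj (x ** y) = cj y ** cj x.
Proof.
elim: n x y => [|n IH]; first by move=> x y; exact: mulrC.
elim/cd_pair_ind=> a b; elim/cd_pair_ind=> c d.
rewrite (cd_conj_pair a) (cd_conj_pair c) !cd_mul_pair cd_conj_pair !cd_conjN cd_conjB.
rewrite !IH !cd_mulNl !cd_mulNr opprK !cd_conjK opprD.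
by rewrite [- (d ** a) - _]addrC.
Qed.

Fixpoint cd_one n : A n := if n is m.+1 then cd_pair (cd_one m) 0 else (1 : R^o).
Local Notation one := (cd_one _).
Lemma cd_oneS n : cd_one n.+1 = cd_pair one 0.
Proof. by []. Qed.

Lemma cd_conj1 n : cj one = one :> A n.
Proof. by elim: n => [//|n IH]; rewrite cd_oneS cd_conj_pair IH oppr0. Qed.

Lemma cd_mul1r n (x : A n) : x ** one = x.
Proof.
elim: n x => [|n IH]; first exact: mulr1.
elim/cd_pair_ind=> a b; rewrite cd_oneS cd_mul_pair cd_conj1 !IH cd_conj0.
by rewrite !cd_mul0l subr0 add0r.
Qed.

Lemma cd_mul1l n (x : A n) : one ** x = x.
Proof. by apply: (can_inj (@cd_conjK n)); rewrite cd_conjM cd_conj1 cd_mul1r. Qed.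

(** * The inner product *)

Fixpoint cd_ip n : A n -> A n -> R := match n return A n -> A n -> R with
  | 0 => fun x y : R => x * y
  | m.+1 => fun x y : A m * A m => cd_ip x.1 y.1 + cd_ip x.2 y.2 end.
Local Notation "<< x , y >>" := (cd_ip x y) (at level 0, x at level 60).
Lemma ip_pair n (a b c d : A n) : << cd_pair a b, cd_pair c d >> = << a, c >> + << b, d >>.
Proof. by []. Qed.

Lemma ipC n (x y : A n) : << x, y >> = << y, x >>.
Proof. elim: n x y => [|n IH] x y /=; [exact: mulrC|by congr (_ + _)]. Qed.

Lemma ip_linear n (x : A n) : linear (cd_ip x : A n -> R^o).
Proof.
elim: n x => [|n IH] x k y z.
  by rewrite /= mulrDr mulrCA.
by rewrite /= !IH scalerDr addrACA.
Qed.

HB.instance Definition _ n (x : A n) :=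
  GRing.isLinear.Build R (A n) R^o *:%R (cd_ip x) (ip_linear x).
Lemma ipDr n (x y z : A n) : << x, y + z >> = << x, y >> + << x, z >>.
Proof. exact: linearD. Qed.

Lemma ipNr n (x y : A n) : << x, - y >> = - << x, y >>.
Proof. exact: linearN. Qed.

Lemma ipZr n k (x y : A n) : << x, k *: y >> = k * << x, y >>.
Proof. exact: linearZ. Qed.

Lemma ip0r n (x : A n) : << x, 0 >> = 0.
Proof. exact: linear0. Qed.

Lemma ipDl n (x y z : A n) : << y + z, x >> = << y, x >> + << z, x >>.
Proof. by rewrite ipC ipDr !(ipC x). Qed.

Lemma ipNl n (x y : A n) : << - y, x >> = - << y, x >>.
Proof. by rewrite ipC ipNr ipC. Qed.

Lemma ipZl n k (x y : A n) : << k *: y, x >> = k * << y, x >>.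
Proof. by rewrite ipC ipZr ipC. Qed.

Lemma ip0l n (x : A n) : << 0, x >> = 0.
Proof. by rewrite ipC ip0r. Qed.

Lemma ip_conj n (x y : A n) : << cj x, cj y >> = << x, y >>.
Proof. by elim: n x y => [//|n IH] x y /=; rewrite IH ipNl ipNr opprK. Qed.

Lemma ip_ge0 n (x : A n) : 0 <= << x, x >>.
Proof. elim: n x => [|n IH] x /=; [exact: sqr_ge0|exact: addr_ge0]. Qed.

Lemma ip_eq0 n (x : A n) : << x, x >> = 0 -> x = 0.
Proof.
elim: n x => [x /eqP|n IH [a b] /= /eqP]; first by rewrite mulf_eq0 orbb => /eqP.
by rewrite paddr_eq0 ?ip_ge0// => /andP[/eqP/IH-> /eqP/IH->].
Qed.

Lemma ip_gt0 n (x : A n) : x != 0 -> 0 < << x, x >>.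
Proof.
by move=> x0; rewrite lt_def ip_ge0 andbT; apply: contraNneq x0 => /ip_eq0->.
Qed.

(** This turns an identity between linear combinations of vectors into one between
    real numbers, where ring applies. *)
Lemma ip_ext n (u v : A n) : (forall w, << u, w >> = << v, w >>) -> u = v.
Proof.
move=> h; apply/eqP; rewrite -subr_eq0; apply/eqP/ip_eq0.
by rewrite ipDl ipNl h subrr.
Qed.

Lemma ip_11 n : << (one : A n), one >> = 1 :> R.
Proof. by elim: n => [|n IH] /=; rewrite ?mulr1// IH ip0l addr0. Qed.

Definition ipE := (ipDl, ipDr, ipNl, ipNr, ipZl, ipZr, ip0l, ip0r).

(** Left and right multiplications by conjugate elements are mutually adjoint.  The
    two statements are equivalent at each level because conjugation is an isometric
    anti-automorphism, and the left one at level n + 1 needs both at level n. *)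
Lemma ip_adjl n (x y z : A n) : << x ** y, z >> = << y, cj x ** z >>.
Proof.
elim: n x y z => [|n IH]; first by move=> x y z; rewrite /= -mulrA mulrCA.
have IHr (x y z : A n) : << x ** y, z >> = << x, z ** cj y >>.
  by rewrite -ip_conj cd_conjM IH cd_conjK -ip_conj cd_conjK cd_conjM cd_conjK.
elim/cd_pair_ind=> a b; elim/cd_pair_ind=> c d; elim/cd_pair_ind=> e f.
rewrite cd_conj_pair !cd_mul_pair !ip_pair cd_mulNr cd_mulNl opprK !ipE.
rewrite IH (IHr _ b) -(ip_conj (cj d)) cd_conjK cd_conjM.
rewrite cd_conjK (IHr d) (IH b) -(ip_conj (cj c)) cd_conjM !cd_conjK.
ring.
Qed.

Lemma ip_adjr n (x y z : A n) : << x ** y, z >> = << x, z ** cj y >>.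
Proof.
by rewrite -ip_conj cd_conjM ip_adjl cd_conjK -ip_conj cd_conjK cd_conjM cd_conjK.
Qed.

Lemma cd_conj_re n (x : A n) : cj x = (2 * << x, one >>) *: one - x.
Proof.
elim: n x => [x|n IH].
  by apply/eqP; rewrite eq_sym subr_eq; apply/eqP;
    change (2 * (x * 1) * 1 = x + x :> R); ring.
elim/cd_pair_ind=> a b; rewrite cd_conj_pair IH ip_pair cd_pairZ cd_pairN cd_pairD !ipE.
by rewrite scaler0 add0r addr0.
Qed.

(** The elements orthogonal to 1 are those sent to their opposite by conjugation, and
    these are called pure. *)
Lemma pureP n (x : A n) : << x, one >> = 0 <-> cj x = - x.
Proof.
rewrite cd_conj_re; split=> [->|/(canRL (addrK _))]; first by rewrite mulr0 scale0r add0r.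
rewrite opprK addNr => H; have := congr1 (cd_ip one) H.
by rewrite !ipE ip_11 mulr1 => /eqP; rewrite mulf_eq0 pnatr_eq0 => /eqP.
Qed.

Lemma conj_pure n (x : A n) : << x, one >> = 0 -> cj x = - x.
Proof. by move/pureP. Qed.

(** * Multiplication by the last imaginary unit *)

Definition cd_i n : A n.+1 := cd_pair 0 one.
(** The left multiplication by i = (0, 1), in coordinates (see cd_mul_il). *)
Definition imul n (x : A n.+1) : A n.+1 := cd_pair (- cj x.2) (cj x.1).
Lemma imul_pair n (a b : A n) : imul (cd_pair a b) = cd_pair (- cj b) (cj a).
Proof. by []. Qed.

Lemma cd_mul_il n (x : A n.+1) : @cd_i n ** x = imul x.
Proof.
by elim/cd_pair_ind: x => a b; rewrite cd_mul_pair cd_mul1l !cd_mul0l cd_mul0r cd_mul1r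
  !add0r.
Qed.

Lemma imulD n (x y : A n.+1) : imul (x + y) = imul x + imul y.
Proof. by rewrite -!cd_mul_il cd_mulDr. Qed.

Lemma imulN n (x : A n.+1) : imul (- x) = - imul x.
Proof. by rewrite -!cd_mul_il cd_mulNr. Qed.

Lemma imulZ n k (x : A n.+1) : imul (k *: x) = k *: imul x.
Proof. by rewrite -!cd_mul_il cd_mulZr. Qed.

Lemma imul0 n : imul (0 : A n.+1) = 0.
Proof. by rewrite -!cd_mul_il cd_mul0r. Qed.

Lemma imul_imul n (x : A n.+1) : imul (imul x) = - x.
Proof. by elim/cd_pair_ind: x => a b; rewrite !imul_pair cd_conjN !cd_conjK cd_pairN. Qed.

Lemma ip_imul_adj n (x y : A n.+1) : << imul x, y >> = - << x, imul y >>.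
Proof.
elim/cd_pair_ind: x => a b; elim/cd_pair_ind: y => c d; rewrite !imul_pair !ip_pair !ipE.
by rewrite -[<< a, _ >>]ip_conj -[<< b, _ >>]ip_conj !cd_conjK; ring.
Qed.

Lemma ip_imul2 n (x y : A n.+1) : << imul x, imul y >> = << x, y >>.
Proof. by rewrite ip_imul_adj imul_imul ipNr opprK. Qed.

Lemma ip_imul_self n (x : A n.+1) : << x, imul x >> = 0.
Proof. by have := ip_imul_adj x x; rewrite ipC; lra. Qed.

Lemma imul1 n : imul one = cd_i n.
Proof. by rewrite cd_oneS imul_pair cd_conj0 cd_conj1 oppr0. Qed.

Lemma imul_i n : imul (cd_i n) = - one.
Proof. by rewrite -imul1 imul_imul. Qed.

Lemma ip_ii n : << cd_i n, cd_i n >> = 1.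
Proof. by rewrite -imul1 ip_imul2 ip_11. Qed.

Lemma ip_1i n : << (one : A n.+1), cd_i n >> = 0.
Proof. by rewrite -imul1 ip_imul_self. Qed.

Lemma ip_pair_i n (a b : A n) : << cd_pair a b, cd_i n >> = << b, one >>.
Proof. by rewrite ip_pair ip0r add0r. Qed.

Lemma ip_pair_1 n (a b : A n) : << cd_pair a b, (one : A n.+1) >> = << a, one >>.
Proof. by rewrite ip_pair ip0r addr0. Qed.

Definition doubly_pure n (x : A n.+1) : Prop := << x, one >> = 0 /\ << x, cd_i n >> = 0.
Lemma doubly_pure_imul n (x : A n.+1) : doubly_pure x -> doubly_pure (imul x).
Proof. by case=> h1 hi; split; rewrite ip_imul_adj ?imul1 ?imul_i ?hi ?ipNr ?h1 ?oppr0. Qed.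

Lemma doubly_pureD n (x y : A n.+1) : doubly_pure x -> doubly_pure y -> doubly_pure (x + y).
Proof. by move=> [h1 h2] [h3 h4]; split; rewrite !ipE ?h1 ?h2 ?h3 ?h4 ?addr0. Qed.

Lemma doubly_pureZ n k (x : A n.+1) : doubly_pure x -> doubly_pure (k *: x).
Proof. by move=> [h1 h2]; split; rewrite !ipE ?h1 ?h2 ?mulr0. Qed.

Lemma doubly_pureN n (x : A n.+1) : doubly_pure x -> doubly_pure (- x).
Proof. by move=> h; rewrite -scaleN1r; exact: doubly_pureZ. Qed.

Lemma doubly_pureB n (x y : A n.+1) : doubly_pure x -> doubly_pure y -> doubly_pure (x - y).
Proof. by move=> hx hy; apply/doubly_pureD/doubly_pureN. Qed.

Lemma doubly_pure0 n : doubly_pure (0 : A n.+1).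
Proof. by split; rewrite ip0l. Qed.

Lemma conj_doubly_pure n (x : A n.+1) : doubly_pure x -> cj x = - x.
Proof. by case=> /pureP. Qed.

Lemma doubly_pure_pair n (a b : A n) : doubly_pure (cd_pair a b) ->
  cj a = - a /\ cj b = - b.
Proof.
by case; rewrite ip_pair_i ip_pair_1 => /pureP -> /pureP ->.
Qed.

Lemma doubly_pure_proj n (x : A n.+1) : << x, one >> = 0 ->
  doubly_pure (x - << x, cd_i n >> *: cd_i n).
Proof.
move=> x1; split; rewrite !ipE; first by rewrite x1 (ipC (cd_i n)) ip_1i mulr0 subr0.
by rewrite ip_ii mulr1 subrr.
Qed.

(** Left multiplication by a doubly pure element is antilinear for the complex
    structure given by i.  This is the source of all later cancellations. *)
Lemma cd_mul_imulr n (x y : A n.+1) : doubly_pure x -> x ** imul y = - imul (x ** y).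
Proof.
elim/cd_pair_ind: x => p q; elim/cd_pair_ind: y => r s /doubly_pure_pair[hp hq].
rewrite imul_pair !cd_mul_pair imul_pair cd_pairN !(cd_conjD, cd_conjN, cd_conjM,
  cd_conjK) hp hq.
rewrite !(cd_mulNl, cd_mulNr, opprK, opprD).
by congr (cd_pair _ _); rewrite addrC.
Qed.

Lemma cd_mul_ir n (x : A n.+1) : doubly_pure x -> x ** cd_i n = - imul x.
Proof. by move=> h; rewrite -imul1 cd_mul_imulr// cd_mul1r. Qed.

Lemma cd_mul_imull n (x y : A n.+1) : doubly_pure x -> doubly_pure y ->
  imul x ** y = (x ** y) ** cd_i n.
Proof.
elim/cd_pair_ind: x => p q; elim/cd_pair_ind: y =>
  r s /doubly_pure_pair[hp hq] /doubly_pure_pair[hr hs].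
rewrite imul_pair !cd_mul_pair hp hq hr hs cd_conj1 cd_conj0 !(cd_mulNl, cd_mulNr, opprK).
by rewrite !cd_mul0r !cd_mul1l add0r addr0 opprB [s ** q + _]addrC.
Qed.

(** Conjugating by i reverses the sign of the part orthogonal to C = span(1, i) and
    fixes C, so up to the component along i it agrees with the involution. *)
Lemma imul_cd_mul_i n (x : A n.+1) :
  - (imul x ** cd_i n) = cj x + (2 * << x, cd_i n >>) *: cd_i n.
Proof.
elim/cd_pair_ind: x => p q; rewrite ip_pair_i imul_pair cd_mul_pair cd_conj_pair
  cd_pairZ cd_pairD cd_pairN.
rewrite cd_conj1 cd_conj0 !cd_mul0r !cd_mul1l scaler0 !addr0 add0r opprK cd_conj_re.
by rewrite opprK cd_conj_re [- q + _]addrC.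
Qed.

Lemma cd_mul_imul2 n (x y : A n.+1) : doubly_pure x -> doubly_pure y ->
  imul x ** imul y = y ** x + (2 * << x ** y, cd_i n >>) *: cd_i n.
Proof.
move=> hx hy; rewrite cd_mul_imull//; last exact: doubly_pure_imul.
by rewrite cd_mul_imulr// cd_mulNl imul_cd_mul_i cd_conjM !conj_doubly_pure// cd_mulNl
  cd_mulNr opprK.
Qed.

Lemma cd_mul_i_eq0 n (x : A n.+1) : x ** cd_i n = 0 -> x = 0.
Proof.
elim/cd_pair_ind: x => p q; rewrite cd_mul_pair cd_conj1 cd_conj0 !cd_mul0r !cd_mul1l
  addr0 add0r.
by rewrite -cd_pair0 => /cd_pair_inj[/eqP]; rewrite oppr_eq0 => /eqP-> ->.
Qed.

#[local] Arguments cayley_dickson : simpl never.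
#[local] Arguments cd_mul : simpl never.
#[local] Arguments cd_conj : simpl never.
#[local] Arguments cd_ip : simpl never.
#[local] Arguments cd_one : simpl never.

(** * Alternativity up to dimension eight *)

Lemma cd_mul_conj_self n (x : A n) : cj x ** x = << x, x >> *: one.
Proof.
have := cd_conj_re (cj x ** x); rewrite cd_conjM cd_conjK ip_adjl cd_conjK cd_mul1r => h.
apply: (scalerI (a := 2)); first by rewrite pnatr_eq0.
by rewrite scalerA -[RHS](subrK (cj x ** x)) -h scaler_nat mulr2n.
Qed.

Lemma cd_mulA_of_comm n : commutative (@cd_mul R n) -> associative (@cd_mul R n) ->
  associative (@cd_mul R n.+1).
Proof.
move=> C S x y z; elim/cd_pair_ind: x => a b; elim/cd_pair_ind: y => c d;
  elim/cd_pair_ind: z => e f.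
have CA (u v w : A n) : u ** (v ** w) = v ** (u ** w) by rewrite S (C u) -S.
rewrite !cd_mul_pair !(cd_conjD, cd_conjN, cd_conjM, cd_conjK).
rewrite !(cd_mulDl, cd_mulDr, cd_mulNl, cd_mulNr, opprD) -!S.
rewrite (CA a (cj f) d) (CA (cj c) (cj f) b) (CA e (cj d) b) (CA b (cj d) f).
rewrite (CA f (cj d) b) (C a d) (C (cj c) b) (C e b) (C c a) (C (cj e) a).
rewrite (C (cj e) (cj c)) (C f b) -!addrA.
by congr (cd_pair (_ + _) (_ + _)); rewrite addrA addrC.
Qed.

Lemma cd_mulC1 : commutative (@cd_mul R 1).
Proof.
elim/cd_pair_ind=> a b; elim/cd_pair_ind=> c d; rewrite !cd_mul_pair.
have C : commutative (@cd_mul R 0) by move=> x y; exact: mulrC.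
have I (x : A 0) : cj x = x by [].
by rewrite !I [c ** a]C [b ** d]C [d ** a + _]addrC.
Qed.

Lemma cd_mulA2 : associative (@cd_mul R 2).
Proof.
apply: cd_mulA_of_comm cd_mulC1 _; apply: cd_mulA_of_comm; first by move=> x y;
  exact: mulrC.
by move=> x y z; exact: mulrA.
Qed.

(** Doubling an associative algebra loses associativity but keeps the left alternative
    law in the form x^* (x y) = |x|^2 y: after expanding, the terms that mix the two
    components of x cancel in pairs by associativity. *)
Lemma cd_alternative_of_assoc n (x y : A n.+1) : associative (@cd_mul R n) ->
  cj x ** (x ** y) = << x, x >> *: y.
Proof.
elim/cd_pair_ind: x => a b; elim/cd_pair_ind: y => c d S.
rewrite cd_conj_pair cd_mul_pair cd_mul_pair !(cd_conjD, cd_conjN, cd_conjM, cd_conjK).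
rewrite !(cd_mulDl, cd_mulDr, cd_mulNl, cd_mulNr, opprD, opprK).
have nr (x : A n) : x ** cj x = << x, x >> *: one.
  by rewrite -{1}[x]cd_conjK cd_mul_conj_self ip_conj.
rewrite !S -(S c (cj b) b) -(S d a (cj a)) nr nr !cd_mul_conj_self.
rewrite !(cd_mulZl, cd_mulZr, cd_mul1l, cd_mul1r) ip_pair cd_pairZ !scalerDl.
by rewrite addrA subrK addrA addrK.
Qed.

Lemma cd_conj_alternative n (x y : A n) : (1 < n <= 3)%N ->
  cj x ** (x ** y) = << x, x >> *: y.
Proof.
case: n x y => [//|[//|[|[|//]]]] x y _; last exact: cd_alternative_of_assoc cd_mulA2.
apply: cd_alternative_of_assoc; apply: cd_mulA_of_comm; first by move=> u v; exact: mulrC.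
by move=> u v w; exact: mulrA.
Qed.

Lemma cd_alternative_l n (x y : A n) : (1 < n <= 3)%N -> cj x = - x ->
  x ** (x ** y) = - (<< x, x >> *: y).
Proof. by move=> hn hx; rewrite -cd_conj_alternative// hx cd_mulNl opprK. Qed.

Lemma cd_alternative_r n (x y : A n) : (1 < n <= 3)%N -> cj x = - x ->
  (y ** x) ** x = - (<< x, x >> *: y).
Proof.
move=> hn hx; apply: (can_inj (@cd_conjK n)).
rewrite !cd_conjM hx !(cd_mulNl, cd_mulNr) opprK cd_alternative_l//.
by rewrite cd_conjN cd_conjZ.
Qed.

(** * Zero divisors are doubly pure *)

(** If x = r + u with u pure, then left multiplication by u is skew-symmetric, so
    <x y, y> = r |y|^2. *)
Lemma zero_divisor_pure n (x y : A n) : x ** y = 0 -> y != 0 -> << x, one >> = 0.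
Proof.
move=> xy /ip_gt0 y0; have := ip_adjl x y y.
rewrite cd_conj_re cd_mulDl cd_mulNl cd_mulZl cd_mul1l xy !ipE subr0.
by move/eqP; rewrite eq_sym !mulf_eq0 pnatr_eq0 (gt_eqF y0) orbF => /eqP.
Qed.

(** Same argument with i y as test vector: if x = t i + u with u doubly pure, then
    <u y, i y> = 0 because multiplications by u and by i are skew-symmetric and
    anticommute. *)
Lemma zero_divisor_doubly_pure n (x y : A n.+1) : x ** y = 0 -> y != 0 -> doubly_pure x.
Proof.
move=> xy y0; have x1 := zero_divisor_pure xy y0; split=> //.
set t := << x, cd_i _ >>; set u := x - t *: cd_i _.
have du : doubly_pure u by exact: doubly_pure_proj.
have uy : u ** y = - (t *: imul y).
  by rewrite /u cd_mulDl xy add0r cd_mulNl cd_mulZl cd_mul_il.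
have := ip_adjl u y (imul y); rewrite conj_doubly_pure// cd_mulNl cd_mul_imulr// opprK
  uy imulN imulZ imul_imul.
rewrite !ipE ip_imul2 => h.
have : t * << y, y >> = 0 by lra.
by move/eqP; rewrite mulf_eq0 (gt_eqF (ip_gt0 y0)) orbF => /eqP.
Qed.

Lemma zero_divisor_doubly_pure_r n (x y : A n.+1) : x ** y = 0 -> x != 0 -> doubly_pure y.
Proof.
move=> xy x0; have [h1 hi] : doubly_pure (cj y).
  apply: (@zero_divisor_doubly_pure _ _ (cj x)); first by rewrite -cd_conjM xy cd_conj0.
  by apply: contra_neq x0 => h; rewrite -[x]cd_conjK h cd_conj0.
have y1 : << y, one >> = 0 by rewrite -ip_conj cd_conj1.
by split=> //; move: hi; rewrite conj_pure// ipNl => /eqP; rewrite oppr_eq0 => /eqP.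
Qed.

(** * Cutting subspaces by linear forms *)

Definition ipf n (v : A n) : 'Hom(A n, R^o) := linfun (cd_ip v : A n -> R^o).
Fact perp_key : unit. Proof. exact tt. Qed.
Definition perp n (v : A n) : {vspace A n} := locked_with perp_key (lker (ipf v)).
Lemma perpE n (v : A n) : perp v = lker (ipf v).
Proof. exact: locked_withE. Qed.

Lemma mem_perp n (v u : A n) : (u \in perp v) = (<< v, u >> == 0).
Proof. by rewrite perpE memv_ker lfunE. Qed.

Lemma mem_cap_perp n (U : {vspace A n}) v u :
  (u \in U :&: perp v)%VS = (u \in U) && (<< v, u >> == 0).
Proof. by rewrite memv_cap mem_perp. Qed.

Lemma dim_perp_ge n (U : {vspace A n}) v : (\dim U <= (\dim (U :&: perp v)).+1)%N.
Proof.
rewrite perpE -(limg_ker_dim (ipf v) U) -addn1 leq_add2l.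
by apply: leq_trans (dimvS (subvf _)) _; rewrite dimvf.
Qed.

Lemma dim_perp n (U : {vspace A n}) v u : u \in U -> << v, u >> != 0 ->
  \dim U = (\dim (U :&: perp v)).+1.
Proof.
move=> uU vu; apply/eqP; rewrite eqn_leq dim_perp_ge /=.
rewrite perpE -(limg_ker_dim (ipf v) U) -addn1 leq_add2l lt0n dimv_eq0.
apply: contraNneq vu => h; have := memv_img (ipf v) uU.
by rewrite h memv0 lfunE.
Qed.

(** The two forms are thought of as the real and imaginary parts of a complex-valued
    one, evaluated on a complex line: their matrix on x, y has determinant
    p^2 + q^2, hence the forms are independent on U. *)
Lemma dim_perp2 n (U : {vspace A n}) v w x y (p q : R) :
  x \in U -> y \in U -> << v, x >> = p -> << w, x >> = q -> << v, y >> = - q ->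
  << w, y >> = p -> p ^+ 2 + q ^+ 2 != 0 ->
  \dim U = (\dim (U :&: perp v :&: perp w)).+2.
Proof.
move=> xU yU vx wx vy wy pq.
rewrite (@dim_perp _ _ v (p *: x - q *: y)); last 2 first.
- by rewrite rpredB// rpredZ.
- by rewrite !ipE vx vy mulrN opprK -!expr2.
congr _.+1; apply: (@dim_perp _ _ w (q *: x + p *: y)).
  by rewrite memv_cap rpredD ?rpredZ// mem_perp !ipE vx vy mulrN mulrC subrr /=.
by rewrite !ipE wx wy addrC -!expr2.
Qed.

Lemma leq_dim_inj (V W : vectType R) (f : 'Hom(V, W)) (U : {vspace V}) (U' : {vspace W}) :
  (forall u, u \in U -> f u \in U') -> (forall u, u \in U -> f u = 0 -> u = 0) ->
  (\dim U <= \dim U')%N.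
Proof.
move=> h1 h2; rewrite -(@limg_dim_eq _ _ _ f U).
  by apply: dimvS; apply/subvP => _ /memv_imgP[u uU ->]; exact: h1.
apply/eqP; rewrite -subv0; apply/subvP => u; rewrite memv_cap memv_ker memv0.
by case/andP=> uU /eqP/(h2 _ uU)->.
Qed.

(** * Annihilators in the doubling of an alternative algebra *)

Definition cd_snd n (x : A n.+1) : A n := x.2.
Lemma cd_snd_linear n : linear (@cd_snd n).
Proof. by []. Qed.

HB.instance Definition _ n :=
  GRing.isLinear.Build R (A n.+1) (A n) *:%R (@cd_snd n) (@cd_snd_linear n).

Lemma dim_Ann_eq0 n (x : A n) : (forall y, x ** y = 0 -> y = 0) -> \dim (Ann x) = 0%N.
Proof.
move=> h; apply/eqP; rewrite dimv_eq0 -subv0; apply/subvP => y.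
by rewrite mem_Ann memv0 => /eqP/h->.
Qed.

Lemma dim_Ann_alternative n (x : A n) : (1 < n <= 3)%N -> x != 0 -> \dim (Ann x) = 0%N.
Proof.
move=> hn /ip_gt0 x0; apply: dim_Ann_eq0 => y xy.
have := cd_conj_alternative x y hn; rewrite xy cd_mul0r => /esym/eqP.
by rewrite scaler_eq0 (gt_eqF x0) => /eqP.
Qed.

(** For (c, d) in the annihilator of (a, b), all four elements are pure, and
    a c = - d b, d a = b c.  Pairing these two equations with 1, a, a b and b a and
    using alternativity shows that d is orthogonal to 1, a, b and a b, while d
    determines c if a <> 0.  If a and b are linearly dependent, the two equations leave
    only c = d = 0.  The subtraction is harmless because 4 <= 2^n. *)
Lemma dim_Ann_over_alternative n (x : A n.+1) : (1 < n <= 3)%N -> x != 0 ->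
  (\dim (Ann x) <= 2 ^ n - 4)%N.
Proof.
move=> hn x0; case: (eqVneq (\dim (Ann x)) 0%N) => [->//|].
rewrite dimv_eq0 -vpick0; set z := vpick _ => z0.
have xz : x ** z = 0 by apply/eqP; rewrite -mem_Ann memv_pick.
have hx := zero_divisor_doubly_pure xz z0;
  have zdr y (h : x ** y = 0) := zero_divisor_doubly_pure_r h x0; move: z z0 xz => _ _ _.
elim/cd_pair_ind: x x0 hx zdr => a b x0 hx zdr.
have [ha hb] := doubly_pure_pair hx.
have eqs c d : cd_pair a b ** cd_pair c d = 0 -> [/\ << c, one >> = 0, << d, one >> = 0,
    a ** c = - (d ** b) & d ** a = b ** c].
  move=> h; have := zdr _ h; case; rewrite ip_pair_1 ip_pair_i => c1 d1.
  move: h; rewrite cd_mul_pair (conj_pure c1) (conj_pure d1) cd_mulNl cd_mulNr opprK.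
  rewrite -cd_pair0 => /cd_pair_inj[/eqP]; rewrite addr_eq0 => /eqP h1 /eqP.
  by rewrite subr_eq0 => /eqP h2.
have inj u v : u != 0 -> cj u = - u -> (u ** v = 0 \/ v ** u = 0) -> v = 0 :> A n.
  move=> u0 hu [] huv; [have := cd_alternative_l v hn hu|have := cd_alternative_r v hn hu];
  by rewrite huv ?cd_mul0l ?cd_mul0r => /esym/eqP;
    rewrite oppr_eq0 scaler_eq0 (gt_eqF (ip_gt0 u0)) => /eqP.
have [a0|a0] := eqVneq a 0.
  have b0 : b != 0 by apply: contraNneq x0 => ->; rewrite a0 cd_pair0.
  rewrite dim_Ann_eq0//; elim/cd_pair_ind => c d /eqs[_ _].
  rewrite a0 cd_mul0l cd_mul0r => /eqP; rewrite eq_sym oppr_eq0 => /eqP h1 /esym h2.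
  have -> : c = 0 by apply: (inj b) => //; left.
  have -> : d = 0 by apply: (inj b) => //; right.
  exact: cd_pair0.
have A0 := ip_gt0 a0.
(* Replacing b by its component b' orthogonal to a makes 1, a, b' and a b'
   pairwise orthogonal, with the same span. *)
set k := << a, b >> / << a, a >>; set b' := b - k *: a.
have [b0|b0] := eqVneq b' 0.
  rewrite dim_Ann_eq0//; elim/cd_pair_ind => c d /eqs[_ _].
  move: b0 => /eqP; rewrite subr_eq0 => /eqP->; rewrite cd_mulZl cd_mulZr => h1 h2.
  have : (1 + k ^+ 2) *: (a ** c) = 0.
    by rewrite scalerDl scale1r {1}h1 h2 scalerA expr2 addNr.
  move/eqP; rewrite scaler_eq0 paddr_eq0 ?sqr_ge0// oner_eq0 /= => /eqP ac.
  have -> : c = 0 by apply: (inj a) => //; left.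
  have -> : d = 0 by apply: (inj a) => //; right; rewrite h2 ac scaler0.
  exact: cd_pair0.
have a1 : << a, one >> = 0 by apply/pureP.
have b1 : << b, one >> = 0 by apply/pureP.
have b'1 : << b', one >> = 0 by rewrite !ipE a1 b1 mulr0 subr0.
have ab' : << a, b' >> = 0 by rewrite !ipE mulfVK ?subrr ?gt_eqF.
have aa : a ** a = - << a, a >> *: one.
  by rewrite -[X in X ** _]opprK -ha cd_mulNl cd_mul_conj_self scaleNr.
have hb' : cj b' = - b' by apply/pureP.
pose U := (fullv :&: perp one :&: perp a :&: perp b' :&: perp (a ** b'))%VS : {vspace A n}.
have ip_ab' u : << a ** b', u >> = - << b', a ** u >>.
  by rewrite ip_adjl ha cd_mulNl ipNr.
apply: leq_trans (_ : \dim U <= _)%N.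
  apply: (leq_dim_inj (f := linfun (@cd_snd n))).
    elim/cd_pair_ind=> c d; rewrite mem_Ann lfunE /= => /eqP/eqs[c1 d1 h1 h2].
    have e1 y : << c, a ** y >> + << d, y ** b >> = 0.
      have := congr1 (cd_ip y) h1; rewrite ipNr ipC ip_adjl ha cd_mulNl ipNr.
      rewrite [<< y, _ >>]ipC ip_adjr hb cd_mulNr ipNr; lra.
    have e2 y : << d, y ** a >> = << c, b ** y >>.
      have := congr1 (cd_ip y) h2; rewrite ipC ip_adjr ha cd_mulNr ipNr.
      rewrite [<< y, _ >>]ipC ip_adjl hb cd_mulNl ipNr; lra.
    (* The pairings with 1 relate <c, a> to <d, b> and <d, a> to <c, b> with opposite
       signs, so the pairings with a b and b a leave only multiples of |a|^2 + |b|^2. *)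
    have e3 := e1 one; have e4 := e2 one; have e5 := e1 a.
    have e6 := e1 (a ** b); have e7 := e2 (b ** a).
    move: e3 e4 e5 e6 e7; rewrite !cd_mul1l !cd_mul1r aa.
    rewrite !(cd_alternative_l _ hn)// !(cd_alternative_r _ hn)// !ipE c1 => e3 e4 e5 e6 e7.
    have da : << d, a >> = 0.
      have : (<< a, a >> + << b, b >>) * << d, a >> = 0 by rewrite mulrDl {1}e4; lra.
      by move/eqP; rewrite mulf_eq0 gt_eqF ?ltr_wpDr ?ip_ge0//= => /eqP.
    have db : << d, b >> = 0.
      have : (<< a, a >> + << b, b >>) * << d, b >> = 0.
        have ca : << c, a >> = - << d, b >> by lra.
        by move: e7; rewrite ca mulrDl; lra.
      by move/eqP; rewrite mulf_eq0 gt_eqF ?ltr_wpDr ?ip_ge0//= => /eqP.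
    have dab : << d, a ** b >> = 0 by lra.
    have da' : << d, a ** b' >> = 0.
      by rewrite /b' cd_mulDr cd_mulNr cd_mulZr aa !ipE dab d1 !mulr0 subrr.
    rewrite !memv_cap memvf !mem_perp !(ipC _ d) da da' d1 /b' !ipE db da.
    by rewrite mulr0 subrr eqxx.
  elim/cd_pair_ind=> c d; rewrite mem_Ann lfunE => /eqP/eqs[_ _ h1 _];
    rewrite /= /cd_snd /= => d0.
  have -> : c = 0 by apply: (inj a) => //; left; rewrite h1 d0 cd_mul0l oppr0.
  by rewrite d0 cd_pair0.
have N : \dim (fullv : {vspace A n}) = (\dim U).+4.
  rewrite (@dim_perp _ _ one one) ?memvf ?ip_11 ?oner_eq0//; congr _.+1.
  rewrite (@dim_perp _ _ a a) ?gt_eqF//; last first.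
    by rewrite !memv_cap memvf mem_perp ipC a1 eqxx.
  congr _.+1; rewrite (@dim_perp _ _ b' b') ?gt_eqF ?ip_gt0//; last first.
    by rewrite !memv_cap memvf !mem_perp ipC b'1 ab' !eqxx.
  congr _.+1; apply: (@dim_perp _ _ _ (a ** b')); last first.
    by rewrite ip_ab' cd_alternative_l// ipNr ipZr opprK mulf_neq0 ?gt_eqF ?ip_gt0.
  rewrite !memv_cap memvf !mem_perp ![<< _, a ** b' >>]ipC !ip_ab' aa cd_mul1r.
  have bab : << b', a ** b' >> = 0 by have := ip_ab' b'; rewrite ipC; lra.
  by rewrite ipZr b'1 (ipC b' a) ab' bab mulr0 oppr0 eqxx.
by move: N; rewrite dimvf dim_cayley_dickson => ->; rewrite -addn4 addnK.
Qed.

(** * The splitting of pairs of doubly pure elements *)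

Lemma doubly_pure_swap n (x y : A n.+1) : doubly_pure x -> doubly_pure y ->
  y ** x = - (2 * << x, y >>) *: one - x ** y.
Proof.
move=> hx hy; have : y ** x = cj (x ** y).
  by rewrite cd_conjM !conj_doubly_pure// cd_mulNl cd_mulNr opprK.
rewrite cd_conj_re => ->; congr (_ *: _ - _).
by rewrite ip_adjl cd_mul1r conj_doubly_pure// ipNr ipC mulrN.
Qed.

Lemma ip_muli n (x y : A n.+1) : doubly_pure x -> << x ** y, cd_i n >> = << imul x, y >>.
Proof. by move=> hx; rewrite ip_adjl conj_doubly_pure// cd_mulNl cd_mul_ir// opprK ipC. Qed.

Lemma ip_mul1 n (x y : A n.+1) : doubly_pure x -> << x ** y, one >> = - << x, y >>.
Proof. by move=> hx; rewrite ip_adjl cd_mul1r conj_doubly_pure// ipNr ipC. Qed.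

(** Every (u, v) with u and v doubly pure has this form (pm_surj).  The elements
    pm a 0 = (a, i a) and pm 0 b = (b, - i b) make up two subspaces that are
    exchanged by (u, v) |-> (u, - v). *)
Definition pm n (a b : A n.+1) : A n.+2 := cd_pair (a + b) (imul (a - b)).

(** For doubly pure elements, the part of x y orthogonal to C = span(1, i) is antilinear
    in both variables and alternating, so it cancels in (a, i a) ** (d, - i d).  This is
    why the cross products a d and b c enter only through inner products. *)
Lemma cd_mul_pm n (a b c d : A n.+1) : doubly_pure a -> doubly_pure b ->
  doubly_pure c -> doubly_pure d ->
  pm a b ** pm c d =
  cd_pair (2 *: (a ** c + b ** d + << a - b, imul (c - d) >> *: cd_i n))
     (2 *: ((b ** d - a ** c +
        (<< b, d >> - << a, c >> + << a, d >> - << b, c >>) *: one) ** cd_i n)).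
Proof.
move=> ha hb hc hd; rewrite /pm cd_mul_pair (conj_doubly_pure (doubly_pure_imul
  (doubly_pureB hc hd))) cd_mulNl opprK.
rewrite (cd_mul_imul2 (doubly_pureB hc hd) (doubly_pureB ha hb)) (conj_doubly_pure
  (doubly_pureD hc hd)) cd_mulNr.
rewrite (cd_mul_imull (doubly_pureB hc hd) (doubly_pureD ha hb)) (cd_mul_imull
  (doubly_pureB ha hb) (doubly_pureD hc hd)) -cd_mulNl -cd_mulDl.
rewrite -cd_mulZl (ip_muli _ (doubly_pureB hc hd)) [<< imul _, _ >>]ipC.
congr (cd_pair _ (_ ** _)); apply: ip_ext => w.
  by rewrite !(cd_mulDl, cd_mulDr, cd_mulNl, cd_mulNr, ipDl, ipNl, ipZl); ring.
rewrite !(cd_mulDl, cd_mulDr, cd_mulNl, cd_mulNr).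
rewrite (doubly_pure_swap ha hc) (doubly_pure_swap hb hd) (doubly_pure_swap hb hc)
  (doubly_pure_swap ha hd).
by rewrite !(ipDl, ipNl, ipZl); ring.
Qed.

Lemma ip_pm n (a b c d : A n.+1) :
  << pm a b, pm c d >> = 2 * (<< a, c >> + << b, d >>).
Proof. by rewrite ip_pair ip_imul2 !ipE; ring. Qed.

Lemma pmD n (a b c d : A n.+1) : pm a b + pm c d = pm (a + c) (b + d).
Proof. by rewrite /pm cd_pairD -imulD; congr (cd_pair _ (imul _)); apply: ip_ext => w;
  rewrite !ipE; ring. Qed.

Lemma pmZ n k (a b : A n.+1) : k *: pm a b = pm (k *: a) (k *: b).
Proof. by rewrite /pm cd_pairZ -imulZ scalerDr scalerBr. Qed.

Lemma pm_eq0 n (a b : A n.+1) : pm a b = 0 -> a = 0 /\ b = 0.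
Proof.
move=> h; have := ip_pm a b a b; rewrite h ip0l => /esym/eqP.
rewrite mulf_eq0 pnatr_eq0 paddr_eq0 ?ip_ge0// => /andP[/eqP/ip_eq0 -> /eqP/ip_eq0 ->].
by [].
Qed.

Lemma doubly_pure_pm n (a b : A n.+1) : doubly_pure a -> doubly_pure b ->
  doubly_pure (pm a b).
Proof.
move=> ha hb; have [h1 _] := doubly_pureD ha hb;
  have [h2 _] := doubly_pure_imul (doubly_pureB ha hb).
by split; [rewrite /pm ip_pair_1|rewrite /pm ip_pair_i].
Qed.

Lemma pm_surj n (u v : A n.+1) : doubly_pure u -> doubly_pure v ->
  exists a b, [/\ doubly_pure a, doubly_pure b & cd_pair u v = pm a b].
Proof.
move=> hu hv; exists (2^-1 *: (u - imul v)), (2^-1 *: (u + imul v)); split.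
- exact/doubly_pureZ/doubly_pureB/doubly_pure_imul.
- exact/doubly_pureZ/doubly_pureD/doubly_pure_imul.
rewrite /pm; congr (cd_pair _ _); apply: ip_ext => w;
  rewrite ?(imulD, imulN, imulZ, imul_imul) !ipE; field; done.
Qed.

(** For a doubly pure this is the component of a c orthogonal to span(1, i): the
    coordinates of a c along 1 and i are - <a, c> and <i a, c>. *)
Definition off_plane n (a c : A n.+1) : A n.+1 :=
  a ** c + << a, c >> *: one - << imul a, c >> *: cd_i n.
Lemma off_plane_linear n (a : A n.+1) : linear (off_plane a).
Proof.
move=> k x y; apply: ip_ext => w.
by rewrite /off_plane cd_mulDr cd_mulZr !ipE; ring.
Qed.

HB.instance Definition _ n (a : A n.+1) :=
  GRing.isLinear.Build R (A n.+1) (A n.+1) *:%R (off_plane a) (off_plane_linear a).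
Fact quasi_Ann_key : unit. Proof. exact tt. Qed.
(** For a nonzero doubly pure a, the annihilator of a is cut out of this space by two
    real equations, and the space also contains a and i a. *)
Definition quasi_Ann n (a : A n.+1) : {vspace A n.+1} := locked_with quasi_Ann_key
  (lker (linfun (off_plane a)) :&: perp one :&: perp (cd_i n))%VS.
Lemma quasi_AnnP n (a c : A n.+1) : reflect
  (doubly_pure c /\ a ** c = - << a, c >> *: one + << imul a, c >> *: cd_i n) (c \in
    quasi_Ann a).
Proof.
rewrite /quasi_Ann locked_withE 2!mem_cap_perp memv_ker lfunE.
rewrite -[X in X == 0]/(off_plane a c) (ipC one) (ipC (cd_i n)).
apply: (iffP idP) => [/andP[/andP[/eqP h /eqP h1] /eqP h2]|[[-> ->] h]].
  split=> //; apply: ip_ext => w; have := congr1 (cd_ip w) h.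
  by rewrite /off_plane ![<< w, _ >>]ipC !ipE; lra.
rewrite !eqxx !andbT /off_plane h; apply/eqP; apply: ip_ext => w; rewrite !ipE; ring.
Qed.

Lemma quasi_Ann_doubly_pure n (a c : A n.+1) : c \in quasi_Ann a -> doubly_pure c.
Proof. by case/quasi_AnnP. Qed.

Lemma quasi_Ann_self n (a : A n.+1) : doubly_pure a -> a \in quasi_Ann a.
Proof.
move=> ha; apply/quasi_AnnP; split=> //;
  rewrite [<< imul a, _ >>]ipC ip_imul_self scale0r addr0.
by rewrite -[X in X ** _]opprK -(conj_doubly_pure ha) cd_mulNl cd_mul_conj_self scaleNr.
Qed.

Lemma quasi_Ann_imul n (a c : A n.+1) : doubly_pure a -> c \in quasi_Ann a ->
  imul c \in quasi_Ann a.
Proof.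
move=> ha /quasi_AnnP[hc h]; apply/quasi_AnnP; split; first exact: doubly_pure_imul.
rewrite cd_mul_imulr// h imulD !imulZ imul1 imul_i ip_imul2 -[<< a, imul c >>]opprK
  -ip_imul_adj.
by apply: ip_ext => w; rewrite !ipE; ring.
Qed.

Lemma mem_quasi_Ann0 n (c : A n.+1) : doubly_pure c -> c \in quasi_Ann 0.
Proof. by move=> hc; apply/quasi_AnnP;
  rewrite cd_mul0l imul0 !ip0l oppr0 !scale0r addr0. Qed.

(** Once the factor i is removed from the second component of the product, the sum and
    the difference of the components separate a c from b d up to elements of span(1, i);
    this forces both to lie in that plane, and the coordinates along 1 and i give the
    four equations. *)
Lemma cd_mul_pm_eq0 n (a b c d : A n.+1) : doubly_pure a -> doubly_pure b ->
  doubly_pure c -> doubly_pure d ->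
  pm a b ** pm c d = 0 <->
  [/\ c \in quasi_Ann a, d \in quasi_Ann b,
   << a, c >> + << b, d >> = 0 /\ << imul a, c >> = << imul b, d >> &
   << b, c >> = << a, d >> /\ << imul b, c >> + << imul a, d >> = 0].
Proof.
move=> ha hb hc hd; rewrite cd_mul_pm//.
set tau := << a - b, _ >>; set s := (<< b, d >> - _ + _ - _).
have tauE : tau = - << imul a, c >> + << imul a, d >> + << imul b, c >> - << imul b, d >>.
  by rewrite /tau imulD imulN !ipE !ip_imul_adj; ring.
split; last first.
  case=> /quasi_AnnP[_ ac] /quasi_AnnP[_ bd] [e1 e2] [e3 e4].
  have sE : s = 2 * << b, d >> by rewrite /s; lra.
  have tE : tau = - 2 * << imul a, c >> by lra.
  rewrite -cd_pair0; congr cd_pair; apply/eqP; rewrite scaler_eq0 pnatr_eq0 /=; apply/eqP.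
    apply: ip_ext => w; rewrite ac bd tE !ipE.
    have -> : << b, d >> = - << a, c >> by lra.
    by rewrite -e2; ring.
  rewrite -[RHS](cd_mul0l (cd_i n)); congr (_ ** _).
  apply: ip_ext => w; rewrite ac bd sE !ipE.
  have -> : << b, d >> = - << a, c >> by lra.
  by rewrite -e2; ring.
rewrite -cd_pair0 => /cd_pair_inj[/eqP]; rewrite scaler_eq0 pnatr_eq0 /= => /eqP E1 /eqP.
rewrite scaler_eq0 pnatr_eq0 /= => /eqP/cd_mul_i_eq0 E2.
have p1 := congr1 (cd_ip one) E1; have p2 := congr1 (cd_ip (cd_i n)) E1.
have p3 := congr1 (cd_ip one) E2; have p4 := congr1 (cd_ip (cd_i n)) E2.
move: p1 p2 p3 p4; rewrite !ipE ![<< one, _ ** _ >>]ipC ![<< cd_i n, _ >>]ipC.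
rewrite !ip_mul1// !ip_muli// (ipC _ one) ip_1i ip_11 ip_ii => p1 p2 p3 p4.
have q1 : << b, c >> = << a, d >> by rewrite /s in p3; lra.
have q2 : << imul b, c >> + << imul a, d >> = 0 by rewrite tauE in p2; lra.
have q3 : << a, c >> + << b, d >> = 0 by lra.
have q4 : << imul a, c >> = << imul b, d >> by lra.
split=> //; apply/quasi_AnnP; split=> //.
  apply: ip_ext => w; have := congr1 (cd_ip w) E1; have := congr1 (cd_ip w) E2.
  rewrite ![<< w, _ >>]ipC !ipE.
  have -> : s = - 2 * << a, c >> by lra.
  have -> : tau = - 2 * << imul a, c >> by lra.
  lra.
apply: ip_ext => w; have := congr1 (cd_ip w) E1; have := congr1 (cd_ip w) E2.
rewrite ![<< w, _ >>]ipC !ipE.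
have -> : s = 2 * << b, d >> by lra.
have -> : tau = - 2 * << imul b, d >> by lra.
lra.
Qed.

(** * Annihilators of split elements *)

Lemma dim_fullv_cd n : \dim (fullv : {vspace A n}) = (2 ^ n)%N.
Proof. by rewrite dimvf dim_cayley_dickson. Qed.

(** The forms <a, _> and <i a, _> are independent on this space, as one sees on a and
    i a, and their common kernel is the annihilator of a. *)
Lemma dim_quasi_Ann n (a : A n.+1) : doubly_pure a -> a != 0 ->
  \dim (quasi_Ann a) = (\dim (Ann a)).+2.
Proof.
move=> ha a0; have A0 := ip_gt0 a0.
rewrite (@dim_perp2 _ (quasi_Ann a) a (imul a) a (imul a) << a, a >> 0) ?quasi_Ann_self
  ?quasi_Ann_imul ?quasi_Ann_self//; last 4 first.
- by rewrite ipC ip_imul_self.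
- by rewrite ip_imul_self oppr0.
- by rewrite ip_imul2.
- by rewrite expr0n addr0 expf_neq0// gt_eqF.
congr (\dim _).+2; apply/vspaceP => c; rewrite !mem_cap_perp mem_Ann.
apply/idP/eqP => [/andP[/andP[/quasi_AnnP[hc h] /eqP e1] /eqP e2]|ac].
  by rewrite h e1 e2 oppr0 !scale0r addr0.
have hc := zero_divisor_doubly_pure_r ac a0.
have e1 : << a, c >> = 0 by have := ip_mul1 c ha; rewrite ac ip0l; lra.
have e2 : << imul a, c >> = 0 by have := ip_muli c ha; rewrite ac ip0l; lra.
rewrite e1 e2 !eqxx !andbT; apply/quasi_AnnP; split=> //.
by rewrite ac e1 e2 oppr0 !scale0r addr0.
Qed.

Lemma dim_quasi_Ann0 n : (2 ^ n.+1)%N = (\dim (quasi_Ann (0 : A n.+1))).+2.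
Proof.
rewrite -dim_fullv_cd (@dim_perp2 _ fullv one (cd_i n) one (cd_i n) 1 0) ?memvf//;
  last 5 first.
- by rewrite ip_11.
- by rewrite ipC ip_1i.
- by rewrite ip_1i oppr0.
- by rewrite ip_ii.
- by rewrite expr0n addr0 expr1n oner_neq0.
congr (\dim _).+2; apply/vspaceP => c; rewrite !mem_cap_perp memvf /=.
apply/andP/idP => [[/eqP h1 /eqP h2]|/quasi_Ann_doubly_pure[h1 h2]].
  by apply: mem_quasi_Ann0; split; rewrite ipC.
by rewrite ![<< _, c >>]ipC h1 h2.
Qed.

Definition plus n (c : A n.+1) : A n.+2 := pm c 0.
Definition minus n (d : A n.+1) : A n.+2 := pm 0 d.
Lemma plus_linear n : linear (@plus n).
Proof. by move=> k x y; rewrite /plus pmZ pmD scaler0 addr0. Qed.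

Lemma minus_linear n : linear (@minus n).
Proof. by move=> k x y; rewrite /minus pmZ pmD scaler0 addr0. Qed.

HB.instance Definition _ n :=
  GRing.isLinear.Build R (A n.+1) (A n.+2) *:%R (@plus n) (@plus_linear n).
HB.instance Definition _ n :=
  GRing.isLinear.Build R (A n.+1) (A n.+2) *:%R (@minus n) (@minus_linear n).
Definition quasi_Ann_pm n (a b : A n.+1) : {vspace A n.+2} :=
  locked_with quasi_Ann_key (linfun (@plus n) @: quasi_Ann a + linfun (@minus n) @:
    quasi_Ann b)%VS.
Lemma pm_inj n (a b c d : A n.+1) : pm a b = pm c d -> a = c /\ b = d.
Proof.
move=> h; have /pm_eq0[/eqP h1 /eqP h2] : pm (a - c) (b - d) = 0.
  by rewrite -pmD -!scaleN1r -pmZ h scaleN1r subrr.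
by move: h1 h2; rewrite !subr_eq0 => /eqP-> /eqP->.
Qed.

Lemma quasi_Ann_pmP n (a b : A n.+1) z :
  reflect (exists c d, [/\ c \in quasi_Ann a, d \in quasi_Ann b & z =
  pm c d]) (z \in quasi_Ann_pm a b).
Proof.
rewrite /quasi_Ann_pm locked_withE;
  apply: (iffP memv_addP) => [[_ /memv_imgP[c hc ->] [_ /memv_imgP[d hd ->] ->]]|[c [d
  [hc hd ->]]]].
  by exists c, d; split=> //; rewrite !lfunE /= /plus /minus pmD add0r addr0.
exists (plus c); first by rewrite -[plus c](lfunE (@plus n)) memv_img.
by exists (minus d); [rewrite -[minus d](lfunE (@minus n)) memv_img|rewrite pmD add0r
  addr0].
Qed.

Lemma mem_quasi_Ann_pm n (a b c d : A n.+1) :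
  (pm c d \in quasi_Ann_pm a b) = (c \in quasi_Ann a) && (d \in quasi_Ann b).
Proof.
apply/quasi_Ann_pmP/andP => [[c' [d' [hc hd /pm_inj[-> ->]]]]//|[hc hd]].
by exists c, d.
Qed.

Lemma dim_quasi_Ann_pm n (a b : A n.+1) :
  \dim (quasi_Ann_pm a b) = (\dim (quasi_Ann a) + \dim (quasi_Ann b))%N.
Proof.
rewrite /quasi_Ann_pm locked_withE dimv_disjoint_sum.
  congr (_ + _)%N; apply: limg_dim_eq; apply/eqP; rewrite -subv0; apply/subvP => c;
  rewrite memv_cap memv_ker lfunE memv0 => /andP[_ /eqP/pm_eq0[]].
    by move=> -> _.
  by move=> _ ->.
apply/eqP; rewrite -subv0; apply/subvP => z.
rewrite memv_cap => /andP[]; move=> /memv_imgP[c _ ->] /memv_imgP[d _];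
  rewrite !lfunE /= => /pm_inj[-> _].
by rewrite memv0 linear0.
Qed.

(** The four equations of cd_mul_pm_eq0, written as orthogonality to four explicit
    split elements. *)
Definition Ann_pm n (a b : A n.+1) : {vspace A n.+2} :=
 (quasi_Ann_pm a b :&: perp (pm a b) :&: perp (pm (imul a) (- imul b)) :&:
   perp (pm b (- a)) :&: perp (pm (imul b) (imul a)))%VS.

(** Orthogonality to (i, 0) and (0, i) makes both components of an annihilated element
    doubly pure, hence the element split. *)
Lemma Ann_pmE n (a b : A n.+1) : doubly_pure a -> doubly_pure b -> pm a b != 0 ->
  (Ann (pm a b) :&: perp (cd_pair (cd_i n) 0) :&: perp (cd_pair 0 (cd_i n)))%VS =
    Ann_pm a b.
Proof.
move=> ha hb ab0; apply/vspaceP => z.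
have H c d : doubly_pure c -> doubly_pure d ->
  pm a b ** pm c d = 0 <-> pm c d \in Ann_pm a b.
  move=> hc hd; rewrite !mem_cap_perp mem_quasi_Ann_pm !ip_pm !ipNl;
    rewrite cd_mul_pm_eq0//.
  split=> [[-> -> [-> ->] [-> ->]]|]; first by rewrite !subrr !mulr0 !eqxx.
  rewrite !mulf_eq0 pnatr_eq0 /= => /andP[/andP[/andP[/andP[/andP[-> ->]]]]].
  by move=> /eqP -> /eqP h1 /eqP h2 /eqP ->; split=> //; split=> //; lra.
apply/idP/idP.
  rewrite 2!mem_cap_perp mem_Ann => /andP[/andP[/eqP abz]];
    have := zero_divisor_doubly_pure_r abz ab0.
  elim/cd_pair_ind: z abz => u v abz [u1 v1].
  rewrite !ip_pair !ip0l addr0 add0r => /eqP ui /eqP vi.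
  have [||c [d [hc hd E]]] := @pm_surj _ u v.
  - by split; [rewrite -u1 ip_pair_1|rewrite ipC].
  - by split; [rewrite -v1 ip_pair_i|rewrite ipC].
  by rewrite E in abz *; apply/H.
move=> zU; have : z \in quasi_Ann_pm a b.
  by move: zU; rewrite !mem_cap_perp => /andP[/andP[/andP[/andP[]]]].
case/quasi_Ann_pmP=> c [d [/quasi_Ann_doubly_pure hc /quasi_Ann_doubly_pure hd E]];
  move: zU; rewrite E => /(H _ _ hc hd) e.
rewrite 2!mem_cap_perp mem_Ann e eqxx /pm (ip_pair (cd_i n) 0) (ip_pair 0 (cd_i n))
  !ip0l add0r addr0.
by rewrite !(ipC (cd_i n)) (doubly_pureD hc hd).2 (doubly_pure_imul (doubly_pureB hc
  hd)).2 eqxx.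
Qed.

(** The first two equations are already independent on pm a 0 and pm (i a) 0. *)
Lemma dim_quasi_Ann_pm_perp n (a b : A n.+1) : doubly_pure a -> doubly_pure b -> a != 0 ->
  \dim (quasi_Ann_pm a b) = (\dim (quasi_Ann_pm a b :&: perp (pm a b) :&:
    perp (pm (imul a) (- imul b)))).+2.
Proof.
move=> ha hb a0; have A0 := ip_gt0 a0.
apply: (@dim_perp2 _ (quasi_Ann_pm a b) _ _ (pm a 0) (pm (imul a) 0) (2 * << a, a >>) 0);
  rewrite ?mem_quasi_Ann_pm ?quasi_Ann_imul ?quasi_Ann_self ?mem0v ?ip_pm ?ip0r ?addr0
    ?ip_imul2 ?ip_imul_self//.
- by rewrite ipC ip_imul_self mulr0.
- by rewrite mulr0 oppr0.
- by rewrite expr0n addr0 expf_neq0// mulf_neq0 ?pnatr_eq0// gt_eqF.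
Qed.

(** In both cases of the last hypothesis the four equations are independent. *)
Lemma dim_Ann_pm_quasi n (a b : A n.+1) : doubly_pure a -> doubly_pure b -> a != 0 ->
  b = 0 \/ << a, b >> != 0 ->
  (\dim (Ann_pm a b) + 4 = \dim (quasi_Ann a) + \dim (quasi_Ann b))%N.
Proof.
move=> ha hb a0 hab; have A0 := ip_gt0 a0.
rewrite -dim_quasi_Ann_pm (dim_quasi_Ann_pm_perp ha hb)// !addnS addn0; congr _.+2;
  symmetry.
have Jab : << a, imul b >> = - << imul a, b >> by rewrite ip_imul_adj opprK.
have Jba : << b, imul a >> = << imul a, b >> by rewrite ipC.
case: hab => [b0|ab]; subst.
  apply: (@dim_perp2 _ _ _ _ (pm 0 (- a)) (pm 0 (imul a)) (2 * << a, a >>) 0).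
  - rewrite !mem_cap_perp mem_quasi_Ann_pm mem0v (mem_quasi_Ann0 (doubly_pureN ha)) !ip_pm.
    by rewrite imul0 oppr0 !(ip0l, ip0r) addr0 mulr0 eqxx.
  - rewrite !mem_cap_perp mem_quasi_Ann_pm mem0v (mem_quasi_Ann0 (doubly_pure_imul ha))
    !ip_pm.
    by rewrite imul0 oppr0 !(ip0l, ip0r) addr0 mulr0 eqxx.
  - by rewrite ip_pm ip0l add0r ipNl ipNr opprK.
  - by rewrite ip_pm ip0r add0r ipNr ipC ip_imul_self oppr0 mulr0.
  - by rewrite ip_pm ip0l add0r ipNl ip_imul_self oppr0 mulr0.
  - by rewrite ip_pm ip0r add0r ip_imul2.
  - by rewrite expr0n addr0 expf_neq0// mulf_neq0 ?pnatr_eq0// gt_eqF.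
have AB : 0 < << a, a >> + << b, b >> by rewrite ltr_wpDr ?ip_ge0.
(* The combinations |b|^2 a, - |a|^2 b and |b|^2 (i a), |a|^2 (i b) are chosen to
   satisfy the first two equations; the other two then take on them the values
   +- 2 (|a|^2 + |b|^2) <a, b> and +- 2 (|a|^2 + |b|^2) <i a, b>. *)
apply: (@dim_perp2 _ _ _ _ (pm (<< b, b >> *: a) (- (<< a, a >> *: b)))
  (pm (<< b, b >> *: imul a) (<< a, a >> *: imul b))
  (2 * (<< a, a >> + << b, b >>) * << a, b >>)
  (- 2 * (<< a, a >> + << b, b >>) * << imul a, b >>)).
- rewrite !mem_cap_perp mem_quasi_Ann_pm rpredN !rpredZ ?quasi_Ann_self// !ip_pm.
  rewrite !(ipNl, ipNr, ipZr) ![<< imul _, _ >>]ipC !ip_imul_self.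
  by apply/andP; split; apply/eqP; ring.
- rewrite !mem_cap_perp mem_quasi_Ann_pm !rpredZ ?quasi_Ann_imul ?quasi_Ann_self// !ip_pm.
  rewrite !(ipNl, ipNr, ipZr) !ip_imul2 !ip_imul_self.
  by apply/andP; split; apply/eqP; ring.
- by rewrite ip_pm !(ipNl, ipNr, ipZr) (ipC b a); ring.
- by rewrite ip_pm !(ipNl, ipNr, ipZr) (ipC (imul b) a) Jab; ring.
- by rewrite ip_pm !(ipNl, ipNr, ipZr) Jab Jba; ring.
- by rewrite ip_pm !(ipNl, ipNr, ipZr) !ip_imul2 (ipC b a); ring.
rewrite gt_eqF// ltr_pwDl ?sqr_ge0// lt_def sqr_ge0 expf_neq0//.
by rewrite !mulf_neq0 ?pnatr_eq0// gt_eqF.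
Qed.

(** For w with b w in span(1, i), all of pm a b ** pm 0 w has components in span(1, i).
    Since left multiplication by pm a b is skew-symmetric, z is orthogonal to this
    product, which gives a linear equation for the coordinates of z along (i, 0) and
    (0, i); i w gives a second, independent one. *)
Lemma Ann_pm_perp_i n (a b w : A n.+1) z : doubly_pure a -> doubly_pure b -> pm a b != 0 ->
  w \in quasi_Ann b -> << a, w >> != 0 -> pm a b ** z = 0 ->
  << cd_pair (cd_i n) 0, z >> = 0 /\ << cd_pair 0 (cd_i n), z >> = 0.
Proof.
move=> ha hb ab0 wK aw abz; have := zero_divisor_doubly_pure_r abz ab0.
elim/cd_pair_ind: z abz => u v abz []; rewrite ip_pair_1 ip_pair_i => u1 v1.
rewrite !ip_pair !ip0l addr0 add0r (ipC _ u) (ipC _ v).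
have H y : y \in quasi_Ann b -> << imul a, y >> * << u, cd_i n >> + << a, y >> * << v,
  cd_i n >> = 0.
  move=> yK; have hy := quasi_Ann_doubly_pure yK; have [_ by_] := quasi_AnnP _ _ yK.
  have := ip_adjl (pm a b) (cd_pair u v) (pm 0 y).
  rewrite abz ip0l (conj_doubly_pure (doubly_pure_pm ha hb)) cd_mulNl ipNr (cd_mul_pm
    ha hb (doubly_pure0 n) hy).
  rewrite by_ ip_pair !cd_mul0r !ipE !sub0r imulN.
  rewrite !(cd_mulDl, cd_mulZl, cd_mulNl) cd_mul1l cd_mul_il imul_i !ipE u1 v1 !ip_imul_adj.
  by rewrite cd_mul0l ip0r; lra.
have h1 := H _ wK; have h2 := H _ (quasi_Ann_imul hb wK).
rewrite ip_imul2 -[<< a, imul w >>]opprK -ip_imul_adj in h2.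
set p := << a, w >> in aw h1 h2; set q := << imul a, w >> in h1 h2.
set x := << u, _ >> in h1 h2 *; set y := << v, _ >> in h1 h2 *.
have pq : p ^+ 2 + q ^+ 2 != 0.
  by rewrite gt_eqF// ltr_pwDl ?sqr_ge0// lt_def sqr_ge0 expf_neq0.
have ex : (p ^+ 2 + q ^+ 2) * x = 0.
  have -> : (p ^+ 2 + q ^+ 2) * x = p * (p * x + - q * y) + q * (q * x + p * y) by ring.
  by rewrite h1 h2 !mulr0 addr0.
have ey : (p ^+ 2 + q ^+ 2) * y = 0.
  have -> : (p ^+ 2 + q ^+ 2) * y = p * (q * x + p * y) - q * (p * x + - q * y) by ring.
  by rewrite h1 h2 !mulr0 subr0.
by move/eqP: ex; move/eqP: ey; rewrite !mulf_eq0 (negbTE pq) => /eqP-> /eqP->.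
Qed.

Lemma pm_neq0 n (a b : A n.+1) : a != 0 -> pm a b != 0.
Proof. by apply: contra_neq => /pm_eq0[]. Qed.

Lemma dim_Ann_pm n (a b : A n.+1) : doubly_pure a -> doubly_pure b -> a != 0 ->
  b = 0 \/ << a, b >> != 0 -> (\dim (Ann (pm a b)) + 4 =
    \dim (quasi_Ann a) + \dim (quasi_Ann b))%N.
Proof.
move=> ha hb a0 hab; have ab0 := pm_neq0 b a0; rewrite -dim_Ann_pm_quasi// -Ann_pmE//.
congr (\dim _ + 4)%N; apply/vspaceP => z; rewrite 2!mem_cap_perp mem_Ann.
have [abz|//] := eqVneq (pm a b ** z) 0.
have [w wK aw] : exists2 w, w \in quasi_Ann b & << a, w >> != 0.
  case: hab => [->|ab]; last by exists b => //; exact: quasi_Ann_self.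
  by exists a; [exact: mem_quasi_Ann0|rewrite gt_eqF ?ip_gt0].
by have [-> ->] := Ann_pm_perp_i ha hb ab0 wK aw abz; rewrite eqxx.
Qed.

Lemma dim_Ann_pm0 n (a : A n.+1) : doubly_pure a -> a != 0 ->
  (\dim (Ann (pm a 0)) + 4 = \dim (Ann a) + 2 ^ n.+1)%N.
Proof.
move=> ha a0; have := dim_Ann_pm ha (doubly_pure0 n) a0 (or_introl erefl).
by rewrite dim_quasi_Ann// => ->; have := dim_quasi_Ann0 n => ->; lia.
Qed.

Lemma dim_Ann_pm_add n (a b : A n.+1) : doubly_pure a -> doubly_pure b -> << a, b >> != 0 ->
  (\dim (Ann (pm a b)) = \dim (Ann a) + \dim (Ann b))%N.
Proof.
move=> ha hb ab.
have a0 : a != 0 by apply: contraNneq ab => ->; rewrite ip0l.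
have b0 : b != 0 by apply: contraNneq ab => ->; rewrite ip0r.
have := dim_Ann_pm ha hb a0 (or_intror ab); rewrite !dim_quasi_Ann//; lia.
Qed.

(** Only two of the four equations are known to be independent here, and the
    annihilator may exceed its part made of split elements by up to two dimensions. *)
Lemma dim_Ann_pm_le n (a b : A n.+1) : doubly_pure a -> doubly_pure b -> a != 0 -> b != 0 ->
  (\dim (Ann (pm a b)) <= \dim (Ann a) + \dim (Ann b) + 4)%N.
Proof.
move=> ha hb a0 b0; set X := Ann (pm a b).
have h1 := dim_perp_ge X (cd_pair (cd_i n) 0).
have h2 := dim_perp_ge (X :&: perp (cd_pair (cd_i n) 0)) (cd_pair 0 (cd_i n)).
have := dim_quasi_Ann_pm_perp ha hb a0; rewrite dim_quasi_Ann_pm !dim_quasi_Ann// => h3.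
have h4 : (\dim (Ann_pm a b) <= \dim (quasi_Ann_pm a b :&: perp (pm a b) :&:
  perp (pm (imul a) (- imul b))))%N.
  by apply: dimvS; rewrite /Ann_pm; apply: subv_trans (capvSl _ _) (capvSl _ _).
by rewrite Ann_pmE ?pm_neq0// in h2; lia.
Qed.

(** * The upper bound *)

Lemma ip_mul_imul n (x w : A n.+1) : << x, one >> = 0 ->
  << x ** imul w, w >> = - (<< x, cd_i n >> * << w, w >>).
Proof.
move=> x1; set t := << x, cd_i n >>; set u := x - t *: cd_i n.
have du : doubly_pure u by exact: doubly_pure_proj.
have -> : x = u + t *: cd_i n by rewrite subrK.
rewrite cd_mulDl cd_mulZl cd_mul_il imul_imul !ipE.
have := ip_adjl u (imul w) w; rewrite (conj_doubly_pure du) cd_mulNl ipNr (ip_imul_adj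
  w) (cd_mul_imulr w du).
by rewrite ipNl [<< w, _ >>]ipC; lra.
Qed.

Lemma ip_mul_pure_self n (x w : A n) : << x, one >> = 0 -> << w ** x, w >> = 0.
Proof.
move=> x1; have := ip_adjr w x w; rewrite (conj_pure x1) cd_mulNr ipNr.
by rewrite [<< w, _ >>]ipC; lra.
Qed.

(** The kernel of this map contains every pm 0 d = (d, - i d), and consists of such
    elements among the pairs of doubly pure elements. *)
Definition plus_part n (x : A n.+2) : A n.+1 := x.1 - imul x.2.
Lemma plus_part_linear n : linear (@plus_part n).
Proof.
move=> k; elim/cd_pair_ind=> a b; elim/cd_pair_ind=> c d;
  rewrite cd_pairZ cd_pairD /plus_part.
by rewrite imulD imulZ; apply: ip_ext => w; rewrite !ipE; ring.
Qed.

HB.instance Definition _ n :=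
  GRing.isLinear.Build R (A n.+2) (A n.+1) *:%R (@plus_part n) (@plus_part_linear n).

(** If (i w, w) annihilates (u, v), then pairing the two components of the product
    with w yields <u, i> |w|^2 = <v, i> |w|^2 = 0.  So when u or v is not doubly pure,
    plus_part is injective on the annihilator. *)
Lemma dim_Ann_not_pm n (u v : A n.+1) : << u, one >> = 0 -> << v, one >> = 0 ->
  ~ (doubly_pure u /\ doubly_pure v) -> (\dim (Ann (cd_pair u v)) <= 2 ^ n.+1)%N.
Proof.
move=> u1 v1 huv; rewrite -(dim_fullv_cd n.+1).
apply: (leq_dim_inj (f := linfun (@plus_part n))) => [z _|z]; first exact: memvf.
have x0 : cd_pair u v != 0.
  by apply/eqP; rewrite -cd_pair0 => /cd_pair_inj[u0 v0]; apply: huv; rewrite u0 v0;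
    split; exact: doubly_pure0.
rewrite mem_Ann lfunE => /eqP xz; have := zero_divisor_doubly_pure_r xz x0; move: xz.
elim/cd_pair_ind: z => w0 w xz [w01]; rewrite ip_pair_i => w1 /eqP;
  rewrite subr_eq0 => /eqP/= e.
have hw : doubly_pure w.
  by split=> //; move: w01; rewrite ip_pair_1 e ip_imul_adj imul1 => /eqP;
    rewrite oppr_eq0 => /eqP.
rewrite e in xz *; move: xz; rewrite cd_mul_pair (conj_pure w1).
rewrite (conj_doubly_pure (doubly_pure_imul hw)) cd_mulNl cd_mulNr opprK -cd_pair0 =>
  /cd_pair_inj[/eqP]; rewrite addr_eq0 => /eqP h1 /eqP.
rewrite subr_eq0 => /eqP h2.
have := ip_mul_imul w u1; rewrite h1 ipNl ip_mul_pure_self// oppr0 => h3.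
have := ip_mul_imul w v1; rewrite -h2 ip_mul_pure_self// => h4.
have [->|/ip_gt0 w0'] := eqVneq w 0; first by rewrite imul0 cd_pair0.
case: huv; split; split=> //.
  by move/eqP: h3; rewrite eq_sym oppr_eq0 mulf_eq0 (gt_eqF w0') orbF => /eqP.
by move/eqP: h4; rewrite eq_sym oppr_eq0 mulf_eq0 (gt_eqF w0') orbF => /eqP.
Qed.

(** An automorphism of the algebra, exchanging pm a b and pm b a. *)
Definition cd_flip n (x : A n.+1) : A n.+1 := cd_pair x.1 (- x.2).
Lemma cd_flip_linear n : linear (@cd_flip n).
Proof. by move=> k x y; rewrite /cd_flip cd_pairZ cd_pairD scalerN opprD. Qed.

HB.instance Definition _ n :=
  GRing.isLinear.Build R (A n.+1) (A n.+1) *:%R (@cd_flip n) (@cd_flip_linear n).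
Lemma dim_Ann_flip n (u v : A n) :
  (\dim (Ann (cd_pair u v)) <= \dim (Ann (cd_pair u (- v))))%N.
Proof.
apply: (leq_dim_inj (f := linfun (@cd_flip n))) => z; rewrite lfunE;
  elim/cd_pair_ind: z => c d.
  rewrite !mem_Ann /= -[cd_flip _]/(cd_pair c (- d)) !cd_mul_pair.
  rewrite cd_conjN !(cd_mulNl, cd_mulNr) opprK -opprD -cd_pair0 => /eqP/cd_pair_inj[-> ->].
  by rewrite oppr0.
by rewrite -[X in X = 0]/(cd_pair c (- d)) -cd_pair0 => _ /cd_pair_inj[-> /eqP];
  rewrite oppr_eq0 => /eqP->.
Qed.

Lemma leq_4n_exp2 n : (3 < n)%N -> (4 * n <= 2 ^ n)%N.
Proof.
elim: n => // n IH; rewrite ltnS leq_eqVlt => /predU1P[<-//|hn]; have := IH hn.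
rewrite expnS; lia.
Qed.

Lemma dim_Ann_le n (x : A n) : (0 < n)%N -> x != 0 ->
  (\dim (Ann x) + 4 * n <= 2 ^ n + 4)%N.
Proof.
elim: n x => // m IH x _ x0.
have [m3|m4] := leqP m 3.
  case: m x x0 m3 {IH} => [|m] x x0 m3.
    by have := dimvS (subvf (Ann x)); rewrite dim_fullv_cd muln1 leq_add2r.
  have [m1|m1] := leqP m.+1 2.
    by rewrite dim_Ann_alternative//; case: m m1 {x x0 m3} => [|[|]].
  have h : (\dim (Ann x) <= 2 ^ m.+1 - 4)%N by apply: dim_Ann_over_alternative => //; lia.
  move: (\dim (Ann x)) h => k; have -> : m = 2%N by lia.
  by move=> h; apply: leq_trans (leq_add h (leqnn _)) _.
case: m IH x x0 m4 => // m IH x x0 m4.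
have m5 := leq_4n_exp2 m4.
case: (eqVneq (\dim (Ann x)) 0%N) => [->|].
  rewrite expnS; lia.
rewrite dimv_eq0 -vpick0; set z := vpick _ => z0.
have xz : x ** z = 0 by apply/eqP; rewrite -mem_Ann memv_pick.
have hx := zero_divisor_doubly_pure xz z0; move: z z0 xz => _ _ _.
elim/cd_pair_ind: x x0 hx => u v x0 []; rewrite ip_pair_1 ip_pair_i => u1 v1.
(* If a component of x has a nonzero coordinate along i, the annihilator has
   dimension at most half that of the algebra, which is within the bound since
   4 (m + 1) <= 2^(m + 1). *)
have [ui|ui] := eqVneq << u, cd_i m >> 0; last first.
  have : (\dim (Ann (cd_pair u v)) <= 2 ^ m.+1)%N.
    by apply: (dim_Ann_not_pm u1 v1) => -[[_ /eqP]]; rewrite (negbTE ui).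
  by rewrite [(2 ^ m.+2)%N]expnS; lia.
have [vi|vi] := eqVneq << v, cd_i m >> 0; last first.
  have : (\dim (Ann (cd_pair u v)) <= 2 ^ m.+1)%N.
    by apply: (dim_Ann_not_pm u1 v1) => -[_ [_ /eqP]]; rewrite (negbTE vi).
  by rewrite [(2 ^ m.+2)%N]expnS; lia.
have [a [b [ha hb E]]] := pm_surj (conj u1 ui) (conj v1 vi).
have bound0 (c : A m.+1) : doubly_pure c -> c != 0 ->
    (\dim (Ann (pm c 0)) + 4 * m.+2 <= 2 ^ m.+2 + 4)%N.
  by move=> hc c0; have := dim_Ann_pm0 hc c0; have := IH c erefl c0;
    rewrite [(2 ^ m.+2)%N]expnS; lia.
have [b0|b0] := eqVneq b 0.
  rewrite E b0; apply: bound0 => //; apply: contraNneq x0 => a0.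
  by rewrite E a0 b0 /pm subrr imul0 addr0 cd_pair0.
have [a0|a0] := eqVneq a 0.
  have := bound0 b hb b0; have := dim_Ann_flip u v.
  have -> : cd_pair u (- v) = pm b 0.
    move: E; rewrite a0 /pm add0r sub0r imulN subr0 addr0 => /cd_pair_inj[-> ->].
    by rewrite opprK.
  lia.
rewrite E; have := dim_Ann_pm_le ha hb a0 b0; have := IH a erefl a0; have := IH b erefl b0.
rewrite [(2 ^ m.+2)%N]expnS; lia.
Qed.

(** * Every multiple of four below the bound occurs *)

Lemma ex_doubly_pure n : exists2 x : A n.+2, doubly_pure x & x != 0.
Proof.
exists (cd_pair (cd_i n) 0); first by split;
  rewrite ?ip_pair_1 ?ip_pair_i ?ip0l// ipC ip_1i.
apply/eqP; rewrite -cd_pair0 => /cd_pair_inj[h _]; have := ip_ii n.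
by rewrite h ip0l => /eqP; rewrite eq_sym oner_eq0.
Qed.

(** In A_(n+3) the bound 2^(n+3) - 4 (n+3) + 4 on the dimension 4 d reads
    d + n + 2 <= 2^(n+1).  The positivity of the inner products guarantees that F d is
    nonzero and that any two members may be combined by dim_Ann_pm_add. *)
Lemma annihilator_family n : exists F : nat -> A n.+3, forall d e,
  (d + n.+2 <= 2 ^ n.+1)%N -> (e + n.+2 <= 2 ^ n.+1)%N ->
  [/\ doubly_pure (F d), \dim (Ann (F d)) = (4 * d)%N & 0 < << F d, F e >>].
Proof.
elim: n => [|n [F HF]].
  have [x hx x0] := ex_doubly_pure 1; exists (fun=> x) => d e hd _.
  have -> : d = 0%N by lia.
  split=> //; [exact: dim_Ann_alternative|exact: ip_gt0].
(* B is the largest index allowed at level n.  Indices d with N <= d + 1 come from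
   pm (F (d + 1 - N)) 0, which adds 4 N - 4 to the dimension; a smaller d is at most
   N - 2 <= 2 B and splits as a sum of two indices up to B. *)
pose N := (2 ^ n.+1)%N; pose B := (N - n.+2)%N.
have NB : (2 * n + 2 <= N)%N.
  rewrite /N; elim: n {HF F N B} => // n IH; rewrite expnS; lia.
pose G d := if (N <= d.+1)%N then pm (F (d.+1 - N)%N) 0
            else pm (F (minn d B)) (F (d - minn d B)%N).
exists G => d e; rewrite expnS -/N => hd he.
have F0 d' : (d' + n.+2 <= N)%N -> F d' != 0.
  by move=> h; have [_ _] := HF _ _ h h; apply: contraTneq => ->; rewrite ip0l ltxx.
have G1 d' : (d' + n.+3 <= 2 * N)%N -> exists p q, [/\ G d' = pm (F p) q,
    (p + n.+2 <= N)%N & q = 0 \/ exists2 r, (r + n.+2 <= N)%N & q = F r].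
  move=> h; rewrite /G; case: leqP => hN.
    by exists (d'.+1 - N)%N, 0; split=> //; [lia|left].
  exists (minn d' B), (F (d' - minn d' B)%N); rewrite /B; split=> //; first lia.
  by right; exists (d' - minn d' (N - n.+2))%N => //; lia.
have [p [q [Gd hp hq]]] := G1 _ hd; have [p' [q' [Ge hp' hq']]] := G1 _ he.
split.
- rewrite Gd; apply: doubly_pure_pm; first by have [] := HF _ _ hp hp.
  by case: hq => [->|[r hr ->]]; [exact: doubly_pure0|have [] := HF _ _ hr hr].
- rewrite /G; case: leqP => hN.
    have h : (d.+1 - N + n.+2 <= N)%N by lia.
    have [h1 h2 _] := HF _ _ h h.
    have := dim_Ann_pm0 h1 (F0 _ h); rewrite h2 2!expnS -/N; lia.
  have h : (minn d B + n.+2 <= N)%N by rewrite /B; lia.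
  have h' : (d - minn d B + n.+2 <= N)%N by rewrite /B; lia.
  have [h1 h2 h3] := HF _ _ h h'; have [h4 h5 _] := HF _ _ h' h.
  by rewrite dim_Ann_pm_add ?gt_eqF// h2 h5 /B; lia.
rewrite Gd Ge ip_pm mulr_gt0// ltr_wpDr//; last by have [] := HF _ _ hp hp'.
case: hq => [->|[r hr ->]]; first by rewrite ip0l.
case: hq' => [->|[r' hr' ->]]; first by rewrite ip0r.
by have [_ _ /ltW] := HF _ _ hr hr'.
Qed.
End CayleyDicksonAnnihilators.

Theorem theorem1p2 (R : realType) (n : nat) (hn : (1 <= n)%N) :
  (forall x : cayley_dickson R n, x != 0 ->
     (\dim (Ann x))%:Z <= 2 ^+ n - 4 * n%:Z + 4)
  /\
  (forall d : nat, (4 %| d)%N -> d%:Z <= 2 ^+ n - 4 * n%:Z + 4 ->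
     exists x : cayley_dickson R n, \dim (Ann x) = d).
Proof.
have -> : 2 ^+ n = (2 ^ n)%N%:Z :> int by rewrite -[RHS]natz natrX.
split=> [x x0|d /dvdnP[k ->] hd]; first by have := dim_Ann_le hn x0; lia.
case: n hn hd => [//|[|[|n]]] _ hd.
- have -> : k = 0%N by lia.
  by exists (cd_one _ _); apply: dim_Ann_eq0 => y; rewrite cd_mul1l.
- have -> : k = 0%N by lia.
  by exists (cd_one _ _); apply: dim_Ann_eq0 => y; rewrite cd_mul1l.
have [F HF] := annihilator_family R n; have h : (k + n.+2 <= 2 ^ n.+1)%N.
  by move: hd; rewrite 2!expnS; lia.
by have [_ e _] := HF _ _ h h; exists (F k); rewrite e mulnC.
Qed.
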